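(* Let $\mathfrak{G}$ be a group and let $Q$ be a finite spin set, i.e. a finite set with a right action of $\mathfrak{G}$. (a) The $Q$-chromatic function $\chi_\Phi(Q)$, as a function of the $\mathfrak{G}$-gain graph $\Phi$, is determined by the frame matroid $G(\Phi)$ and the numbers of components and balanced components of $\Phi$, if and only if there is $q_0\in Q$ such that every nonidentity element of $\mathfrak{G}$ has fixed set $\{q_0\}$ in $Q$. (b) The $Q$-chromatic function $\chi_\Phi(Q)$, as a function of the $\mathfrak{G}$-gain graph $\Phi$, is determined by the balanced semimatroid of $\Phi$ and the numbers of components and balanced components of $\Phi$ if and only if $\mathfrak{G}$ acts regularly or trivially upon $Q$.
   Context: Graphs have finitely many vertices and may have loops and multiple edges. A $\mathfrak{G}$-gain graph $\Phi=(\Gamma,\phi)$ consists of an underlying graph $\Gamma=(V,E)$ and a gain function $\phi$ assigning to each oriented edge an element of $\mathfrak{G}$, with $\phi(e^{-1})=\phi(e)^{-1}$, where $e^{-1}$ is $e$ with the opposite orientation. A state is any function $s:V\to Q$. An edge $e$ oriented from $v$ to $w$ (possibly $v=w$) is satisfied in $s$ if $s_w=s_v\phi(e)$ and frustrated otherwise. A state is totally frustrated if every edge is frustrated. The $Q$-chromatic function $\chi_\Phi(Q)$ is the number of totally frustrated states of $\Phi$ with spins in $Q$. A gain graph or edge set is balanced if every simple closed walk in it (loops included) has gain $1$, the gain of a walk being the product of the gains of its edges in cyclic order. For $A\subseteq E$, $\Phi|A$ denotes the spanning subgraph with vertex set $V$ and edge set $A$, and $b(\Phi|A)$ is its number of balanced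 connected components, isolated vertices counting as balanced components. The frame (bias) matroid $G(\Phi)$ is the matroid on the ground set $E$ with rank function $r(A)=|V|-b(\Phi|A)$. The balanced semimatroid of $\Phi$ is the class of balanced edge sets (subsets of the ground set $E$) together with their ranks as in $G(\Phi)$. ''Determined'' means that two $\mathfrak{G}$-gain graphs having isomorphic frame matroids (in (a)) or isomorphic balanced semimatroids (in (b)), the same number of connected components, and the same number of balanced connected components, have the same value of the $Q$-chromatic function. The fixed set of $g\in\mathfrak{G}$ is $\{q\in Q: qg=q\}$. The action of $\mathfrak{G}$ on $Q$ is trivial if every spin is fixed by every group element, and regular if only the identity element has any fixed points.
   Formalization: Part (a) is stated for nonempty Q only: if Q is empty, the chromatic function is 1 or 0 according to whether V is empty, hence determined by the number of components, yet no q_0 in Q exists, so (a) fails there; (b) covers every finite Q. *)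

(* Defs.v *)
From mathcomp Require Import all_boot.
From mathcomp Require Import boolp classical_sets.

Set Implicit Arguments.
Unset Strict Implicit.
Unset Printing Implicit Defensive.

Local Open Scope group_scope.

(* MathComp's bundled actions only cover finite acting groups. *)
Definition is_right_action (G : groupType) (Q : Type) (act : Q -> G -> Q) :=
  (forall q, act q 1 = q) /\ (forall q g h, act q (g * h) = act (act q g) h).

Definition fixed_set (G : groupType) (Q : finType) (act : Q -> G -> Q) (g : G)
  : {set Q} := [set q | act q g == q]%SET.

Definition trivial_action (G : groupType) (Q : finType) (act : Q -> G -> Q) :=
  forall g q, q \in fixed_set act g.

Definition regular_action (G : groupType) (Q : finType) (act : Q -> G -> Q) :=
  forall g q, q \in fixed_set act g -> g = 1.

(* Vertices are finite in number, edges need not be. Every edge e, loops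
   included, has the two orientations (e, false) and (e, true); the first one
   goes from [tail0 e] to [head0 e]. *)
Record gain_graph (G : groupType) := GainGraph {
  vertex : finType;
  edge : choiceType;
  tail0 : edge -> vertex;
  head0 : edge -> vertex;
  gain : edge * bool -> G;
  gainV : forall e b, gain (e, ~~ b) = (gain (e, b))^-1 }.

Arguments tail0 {G} _ _.
Arguments head0 {G} _ _.
Arguments gain {G} _ _.

Section GainGraphs.
Variables (G : groupType) (Phi : gain_graph G).

Definition dart : Type := (edge Phi * bool)%type.

Definition source (d : dart) : vertex Phi :=
  if d.2 then head0 Phi d.1 else tail0 Phi d.1.

Definition target (d : dart) : vertex Phi :=
  if d.2 then tail0 Phi d.1 else head0 Phi d.1.

(* No repeated vertex and no repeated edge: in particular an edge followed by
   its reverse is excluded, while a loop and two parallel edges are allowed. *)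
Definition simple_closed_walk (w : seq dart) : bool :=
  [&& 0 < size w,
      cycle (fun d d' => target d == source d') w,
      uniq (map source w)
    & uniq (map fst w)].

Definition walk_gain (w : seq dart) : G := \prod_(d <- w) gain Phi d.

Definition balanced (A : set (edge Phi)) : Prop :=
  forall w : seq dart, simple_closed_walk w ->
    (forall d, d \in w -> A d.1) -> walk_gain w = 1.

Definition adjacent (A : set (edge Phi)) : rel (vertex Phi) :=
  fun v w => `[< exists d : dart, [/\ A d.1, source d = v & target d = w] >].

Definition components (A : set (edge Phi)) : {set {set vertex Phi}} :=
  equivalence_partition (connect (adjacent A)) [set: vertex Phi]%SET.

Definition edges_in (A : set (edge Phi)) (X : {set vertex Phi}) :
  set (edge Phi) :=
  fun e => [/\ A e, tail0 Phi e \in X & head0 Phi e \in X].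

Definition num_components (A : set (edge Phi)) : nat := #|components A|.

Definition num_balanced_components (A : set (edge Phi)) : nat :=
  #|[set X in components A | `[< balanced (edges_in A X) >]]%SET|.

Definition frame_rank (A : set (edge Phi)) : nat :=
  (#|vertex Phi| - num_balanced_components A)%N.

Section States.
Variables (Q : finType) (act : Q -> G -> Q).

Definition satisfied (s : {ffun vertex Phi -> Q}) (d : dart) : Prop :=
  s (target d) = act (s (source d)) (gain Phi d).

(* For a right action, whether an edge is satisfied does not depend on its
   orientation; hence quantifying over darts is quantifying over edges. *)
Definition totally_frustrated (s : {ffun vertex Phi -> Q}) : Prop :=
  forall d : dart, ~ satisfied s d.

Definition chromatic : nat :=
  #|[set s : {ffun vertex Phi -> Q} | `[< totally_frustrated s >]]%SET|.

End States.
End GainGraphs.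

(* The frame matroid is represented by its rank function, the balanced
   semimatroid by the balanced edge sets and their ranks; both live on the whole
   edge set, so that isomorphisms are bijections between all edges. *)
Definition frame_matroid_iso (G : groupType) (Phi Psi : gain_graph G) : Prop :=
  exists2 f : edge Phi -> edge Psi, bijective f &
    forall A : set (edge Phi), frame_rank (f @` A)%classic = frame_rank A.

Definition balanced_semimatroid_iso (G : groupType) (Phi Psi : gain_graph G) :
  Prop :=
  exists2 f : edge Phi -> edge Psi, bijective f &
    forall A : set (edge Phi),
      (balanced (f @` A)%classic <-> balanced A) /\
      (balanced A -> frame_rank (f @` A)%classic = frame_rank A).

Definition chromatic_determined_by (G : groupType) (Q : finType)
    (act : Q -> G -> Q) (iso : gain_graph G -> gain_graph G -> Prop) : Prop :=
  forall Phi Psi : gain_graph G,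
    iso Phi Psi ->
    @num_components G Phi [set: edge Phi]%classic =
      @num_components G Psi [set: edge Psi]%classic ->
    @num_balanced_components G Phi [set: edge Phi]%classic =
      @num_balanced_components G Psi [set: edge Psi]%classic ->
    chromatic Phi act = chromatic Psi act.

(* Main.v *)
Require Import Defs.
From mathcomp Require Import all_boot.
From mathcomp Require Import boolp classical_sets zify.

(* Let b(A) and c(A) count the balanced and all components of the spanning
   subgraph with edge set A. The states satisfying A correspond to choosing, at
   one root of each component, a spin fixed by the gains of all closed walks at
   that root. If the nonidentity elements have the common fixed set {q0} there
   are |Q|^b(A) of them; if the action is trivial there are |Q|^c(A); if it is
   regular there are |Q|^c(A) when A is balanced and none otherwise. By
   inclusion-exclusion these numbers determine the chromatic function, finitely
   many edges being enough to frustrate every state that is not totally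
   frustrated. Finally, b(A) is read off the frame rank, while c(A) is read off
   the ranks of the balanced subsets of A, because A contains a balanced spanning
   forest.
   Conversely, for g <> 1 with k fixed spins, a link with an unbalanced loop and
   two parallel links forming an unbalanced digon have the same frame matroid
   U_{2,2}, and equality of their chromatic functions means |Q| = k |Q|; two loops
   of gains g, h at one vertex then force g and h to have the same fixed spin. The
   balanced semimatroid does not see at which end of a link an unbalanced loop is
   attached, nor its gain, which forces the action to be regular or trivial. *)

Set Implicit Arguments.
Unset Strict Implicit.
Unset Printing Implicit Defensive.

Lemma not_uniq_map_split (T U : eqType) (f : T -> U) (s : seq T) :
  ~~ uniq (map f s) ->
  exists s1 x s2 y s3, s = s1 ++ x :: s2 ++ y :: s3 /\ f x = f y.
Proof.
elim: s => [|a s IHs] //=; rewrite negb_and negbK => /orP[/mapP[y ys fay]|/IHs].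
  by case/splitPr: ys => s2 s3; exists [::], a, s2, y, s3.
by case=> s1 [x [s2 [y [s3 [-> fxy]]]]]; exists (a :: s1), x, s2, y, s3.
Qed.

(** * Walks, their gains, and balance *)

Section Walks.
Variables (G : groupType) (Phi : gain_graph G).
Implicit Types (A B : set (edge Phi)) (d : dart Phi) (w : seq (dart Phi)).
Implicit Types x y z : vertex Phi.

Definition rev_dart d : dart Phi := (d.1, ~~ d.2).

Lemma source_rev d : source (rev_dart d) = target d.
Proof. by case: d => e []. Qed.

Lemma target_rev d : target (rev_dart d) = source d.
Proof. by case: d => e []. Qed.

Lemma gain_rev d : gain Phi (rev_dart d) = (gain Phi d)^-1%g.
Proof. by case: d => e b; apply: gainV. Qed.

Fixpoint walk A x w y : Prop :=
  if w is d :: w' then [/\ A d.1, source d = x & walk A (target d) w' y]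
  else x = y.

Definition rev_walk w := rev (map rev_dart w).

Lemma walk_gain_nil : walk_gain (Phi := Phi) [::] = 1%g.
Proof. by rewrite /walk_gain big_nil. Qed.

Lemma walk_gain_cons d w : walk_gain (d :: w) = (gain Phi d * walk_gain w)%g.
Proof. by rewrite /walk_gain big_cons. Qed.

Lemma walk_gain_cat w1 w2 :
  walk_gain (w1 ++ w2) = (walk_gain w1 * walk_gain w2)%g.
Proof. by rewrite /walk_gain big_cat. Qed.

Lemma walk_gain_rev w : walk_gain (rev_walk w) = (walk_gain w)^-1%g.
Proof.
elim: w => [|d w IHw]; first by rewrite walk_gain_nil invg1.
rewrite /rev_walk map_cons rev_cons -cats1 walk_gain_cat -/(rev_walk w) IHw.
by rewrite !walk_gain_cons walk_gain_nil mulg1 invgM gain_rev.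
Qed.

Lemma walk_cat A x w1 w2 y :
  walk A x (w1 ++ w2) y <-> exists2 z, walk A x w1 z & walk A z w2 y.
Proof.
elim: w1 x => [|d w1 IHw] x /=.
  by split=> [|[z ->] //]; exists x.
split=> [[Ad dx /IHw[z w1z w2z]]|[z [Ad dx w1z] w2z]]; first by exists z.
by split=> //; apply/IHw; exists z.
Qed.

Lemma walk_rev A x w y : walk A x w y -> walk A y (rev_walk w) x.
Proof.
elim: w x => [|d w IHw] x //= [Ad <- /IHw wyd].
rewrite /rev_walk map_cons rev_cons -cats1; apply/walk_cat; exists (target d) => //=.
by rewrite source_rev target_rev.
Qed.

Lemma walk_sub A B x w y :
  (forall d, d \in w -> A d.1 -> B d.1) -> walk A x w y -> walk B x w y.
Proof.
elim: w x => [|d w IHw] x //= AB [Ad dx wy]; split=> //.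
  by apply: AB => //; rewrite mem_head.
by apply: IHw => // d' d'w; apply: AB; rewrite inE d'w orbT.
Qed.

Lemma connectP_walk A x y :
  connect (adjacent A) x y <-> exists w, walk A x w y.
Proof.
split=> [/connectP[p]|[w]].
  elim: p x => [|z p IHp] x /=; first by move=> _ ->; exists [::].
  case/andP=> /asboolP[d [Ad dx dz]] /IHp/[apply] -[w wzy].
  by exists (d :: w); rewrite /= dx dz.
elim: w x => [|d w IHw] x /=; first by move->; rewrite connect0.
case=> Ad <- /IHw; apply: connect_trans; apply: connect1.
by apply/asboolP; exists d.
Qed.

Lemma connect_adjacent_sym A : connect_sym (adjacent A).
Proof.
move=> x y; apply/idP/idP => /connectP_walk[w /walk_rev wyx];
  by apply/connectP_walk; exists (rev_walk w).
Qed.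

Lemma sub_connect_adjacent A B x y :
  (A `<=` B)%classic ->
  connect (adjacent A) x y -> connect (adjacent B) x y.
Proof.
move=> AB /connectP_walk[w wA]; apply/connectP_walk; exists w.
by apply: walk_sub wA => d _; apply: AB.
Qed.

Lemma walk_path A d w y :
  walk A (target d) w y <->
  [/\ path (fun d d' => target d == source d') d w, target (last d w) = y
    & forall d', d' \in w -> A d'.1].
Proof.
elim: w d => [|d' w IHw] d /=; first by split=> [->|[]].
split=> [[Ad' d'd /IHw[pw -> Aw]]|[/andP[/eqP dd' pw] wy Aw]].
  split=> //; first by rewrite d'd eqxx.
  by move=> d2; rewrite inE => /orP[/eqP->|/Aw].
split=> //; first by apply: Aw; rewrite mem_head.
apply/IHw; split=> // d2 d2w; apply: Aw.
by rewrite inE d2w orbT.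
Qed.

Lemma cycle_walk A d w :
  cycle (fun d d' => target d == source d') (d :: w) /\
    (forall d', d' \in d :: w -> A d'.1) <->
  walk A (source d) (d :: w) (source d).
Proof.
rewrite /= rcons_path; split=> [[/andP[pw /eqP dw] Aw]|[Ad _ /walk_path[pw dw Aw]]].
  split=> //; first by apply: Aw; rewrite mem_head.
  apply/walk_path; split=> // d' d'w; apply: Aw.
  by rewrite inE d'w orbT.
split; first by rewrite pw dw eqxx.
by move=> d'; rewrite inE => /orP[/eqP->|/Aw].
Qed.

(* A closed walk without repeated edge or source is simple; otherwise it is cut
   at the repetition into shorter closed walks, where a repeated edge with
   distinct sources must be traversed in both directions. *)
Lemma balanced_closed_walk A x w :
  balanced A -> walk A x w x -> walk_gain w = 1%g.
Proof.
move=> balA; have [n] := ubnP (size w); elim: n x w => // n IHn x w ltn wx.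
have [us|/not_uniq_map_split] := boolP (uniq (map (@source G Phi) w)); last first.
  case=> w1 [d1 [w2 [d2 [w3 [Dw ss]]]]]; move: wx ltn; rewrite {w}Dw.
  move=> /walk_cat[z w1z]; rewrite -cat_cons => /walk_cat[y [Ad1 Dz w2y] w3y].
  have [_ Dy _] := w3y; subst z y.
  rewrite !walk_gain_cat !size_cat /= => ltn.
  have -> : walk_gain (d1 :: w2) = 1%g.
    apply: (IHn (source d1)); last by rewrite {2}ss.
    by rewrite /=; lia.
  rewrite mul1g -walk_gain_cat; apply: (IHn x); last first.
    by apply/walk_cat; exists (source d1) => //; rewrite ss.
  by rewrite size_cat /=; lia.
have [ue|/not_uniq_map_split] := boolP (uniq (map fst w)).
  case: w ltn wx us ue => [|d w] ltn wx us ue; first by rewrite walk_gain_nil.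
  have [_ dx _] := wx; rewrite -{x}dx in wx.
  have /cycle_walk[cw Aw] := wx.
  by apply: balA => //; apply/and4P.
case=> w1 [d1 [w2 [d2 [w3 [Dw ss]]]]]; move: us wx ltn; rewrite {w}Dw.
have [eq12|] := eqVneq d2.2 d1.2.
  have -> : d2 = d1 by case: d1 d2 ss eq12 => [? ?] [? ?] /= -> ->.
  rewrite map_cat cat_uniq map_cons map_cat map_cons cons_uniq mem_cat mem_head.
  by rewrite orbT !andbF.
move=> ne12 _; have {ss ne12} -> : d2 = rev_dart d1.
  by case: d1 d2 ss ne12 => [? []] [? []] //= ->.
case/walk_cat=> y w1y [/= Ad1 Dy] /walk_cat[z w2z [/= _ Dz w3x]] ltn.
rewrite source_rev in Dz; rewrite target_rev Dy in w3x.
rewrite -{z}Dz in w2z.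
rewrite walk_gain_cat walk_gain_cons walk_gain_cat walk_gain_cons gain_rev.
move: ltn; rewrite size_cat /= size_cat /= !addnS !ltnS => ltn.
(* The part between the two opposite traversals is closed at [target d1], so it has gain 1; the two
   traversals then cancel. *)
rewrite (IHn (target d1) w2) //; last by lia.
rewrite mul1g mulVKg -walk_gain_cat; apply: (IHn x).
  by rewrite size_cat; lia.
by apply/walk_cat; exists y.
Qed.

Lemma balancedP A :
  balanced A <-> (forall x w, walk A x w x -> walk_gain w = 1%g).
Proof.
split=> [balA x w|trivA [|d w] // /and4P[_ cw _ _] Aw].
  exact: balanced_closed_walk.
by apply: (trivA (source d)); apply/cycle_walk.
Qed.

Lemma sub_balanced A B : (A `<=` B)%classic -> balanced B -> balanced A.
Proof. by move=> AB balB w sw Aw; apply: balB => // d /Aw/AB. Qed.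

(** A closed walk at [x] never leaves the component of [x]. Conversely, a closed walk elsewhere in
    the component becomes one at [x] after conjugation by a walk from [x], and an element with
    trivial conjugate is trivial. *)
Lemma balanced_component A x :
  balanced (edges_in A [set y | connect (adjacent A) x y]%SET) <->
  (forall w, walk A x w x -> walk_gain w = 1%g).
Proof.
split=> [/balancedP bal w wx|triv].
  apply: (bal x); move: wx; suff: forall y, connect (adjacent A) x y ->
    forall z, walk A y w z ->
    walk (edges_in A [set y | connect (adjacent A) x y]%SET) y w z.
    by apply; rewrite connect0.
  elim: w => //= d w IHw y xy z [Ad Dy wz].
  have xd : connect (adjacent A) x (target d).
    apply: connect_trans xy (connect1 _); apply/asboolP; by exists d.
  split=> //; last exact: IHw.
  rewrite -{y}Dy in xy.
  by case: d Ad {wz} xy xd => e [] Ad; rewrite /edges_in !inE.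
(* The empty walk is treated apart: only a first dart shows that the base point [y] lies in the
   component of [x]. *)
apply/balancedP => y [|d w] ww; first by rewrite walk_gain_nil.
have xy : connect (adjacent A) x y.
  have [[Ad xt xh] <- _] := ww.
  by case: d {ww} xt xh {Ad} => e []; rewrite !inE.
have /connectP_walk[p px] := xy.
have wA : walk A y (d :: w) y by apply: walk_sub ww => ? _ [].
have /triv : walk A x (p ++ (d :: w) ++ rev_walk p) x.
  apply/walk_cat; exists y => //; apply/walk_cat; exists y => //.
  exact: walk_rev.
rewrite !walk_gain_cat walk_gain_rev mulgA => /eqP.
by rewrite mulg_eq1 invgK => /eqP; rewrite -{2}[walk_gain p]mulg1 => /mulgI.
Qed.

End Walks.

(** * Components, and the number of states satisfying an edge set *)

Section CountingStates.
Variables (G : groupType) (Phi : gain_graph G).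
Implicit Types (A B : set (edge Phi)) (r v : vertex Phi).

Definition closed_walks_trivial A r : Prop :=
  forall w, walk A r w r -> walk_gain w = 1%g.

(** Each component contains exactly one vertex chosen by [root]. Counting roots instead of vertex
    sets matches the product over roots in [card_satisfied_states]. *)
Lemma card_components_with A (P : pred {set vertex Phi}) :
  #|[set X in components A | P X]%SET| =
  #|[set r | roots (adjacent A) r
             && P [set y | connect (adjacent A) r y]%SET]%SET|.
Proof.
pose cls r := [set y | connect (adjacent A) r y]%SET.
have clsE : [set [set y in [set: vertex Phi] | connect (adjacent A) x y]
             | x in [set: vertex Phi]]%SET = (cls @: [set: vertex Phi])%SET.
  by apply: eq_imset => x; apply/setP => y; rewrite !inE.
have csym := connect_adjacent_sym A.
rewrite -(card_in_imset (f := cls)) => [|x y]; last first.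
  rewrite !inE => /andP[/eqP xr _] /andP[/eqP yr _] /setP/(_ y).
  by rewrite !inE connect0 -(root_connect csym) xr yr => /eqP.
apply/eq_card => X; rewrite inE /components /equivalence_partition /= clsE.
apply/andP/imsetP => [[/imsetP[x _ ->] PX]|[r]]; last first.
  by rewrite inE => /andP[_ Pr] ->; rewrite imset_f.
have clsx : cls x = cls (root (adjacent A) x).
  apply/setP => y; rewrite !inE.
  by rewrite (same_connect csym (connect_root (adjacent A) x)).
by exists (root (adjacent A) x); rewrite // inE roots_root // -/(cls _) -clsx.
Qed.

Lemma num_componentsE A : num_components A = #|roots (adjacent A)|.
Proof.
transitivity #|[set X in components A | predT X]%SET|.
  by apply: eq_card => X; rewrite inE andbT.
rewrite card_components_with -[RHS]cardsE.
by apply: eq_card => r; rewrite !inE andbT.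
Qed.

Lemma num_balanced_componentsE A :
  num_balanced_components A =
  #|[set r | roots (adjacent A) r && `[< closed_walks_trivial A r >]]%SET|.
Proof.
rewrite /num_balanced_components card_components_with; apply: eq_card => r.
by rewrite !inE; congr (_ && _); apply: asbool_equiv_eq; apply: balanced_component.
Qed.

Lemma num_balanced_components_le A :
  num_balanced_components A <= num_components A.
Proof.
rewrite num_balanced_componentsE num_componentsE; apply/subset_leq_card/fintype.subsetP.
by move=> r; rewrite inE => /andP[].
Qed.

Lemma num_components_le A : num_components A <= #|vertex Phi|.
Proof. by rewrite num_componentsE max_card. Qed.

Lemma balanced_num_components A :
  balanced A -> num_balanced_components A = num_components A.
Proof.
move=> /balancedP balA; rewrite num_balanced_componentsE num_componentsE.
apply: eq_card => r; rewrite inE andbC (_ : `[< _ >]) //.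
by apply/asboolP => w; apply: balA.
Qed.

Section Action.
Variables (Q : finType) (act : Q -> G -> Q).
Hypothesis act_right : is_right_action act.

Lemma act1 q : act q 1%g = q. Proof. by case: act_right. Qed.

Lemma actM q g h : act q (g * h)%g = act (act q g) h.
Proof. by case: act_right. Qed.

Lemma actK g : cancel (act ^~ g) (act ^~ g^-1%g).
Proof. by move=> q; rewrite -actM mulgV act1. Qed.

Implicit Types s : {ffun vertex Phi -> Q}.

Lemma satisfied_rev s d : satisfied act s (rev_dart d) -> satisfied act s d.
Proof.
rewrite /satisfied source_rev target_rev gain_rev => ->.
by rewrite -{2}[gain Phi d]invgK actK.
Qed.

Definition satisfied_states A : {set {ffun vertex Phi -> Q}} :=
  [set s | `[< forall e, A e -> satisfied act s (e, false) >]]%SET.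

Lemma satisfied_statesP A s :
  reflect (forall d : dart Phi, A d.1 -> satisfied act s d)
          (s \in satisfied_states A).
Proof.
rewrite inE; apply: (iffP (asboolP _)) => sat; last by move=> e; apply: (sat (e, false)).
by case=> e [] /= Ae; [apply: satisfied_rev|]; apply: sat.
Qed.

Lemma satisfied_walk A s x w y :
  s \in satisfied_states A -> walk A x w y -> s y = act (s x) (walk_gain w).
Proof.
move=> /satisfied_statesP satA.
elim: w x => [|d w IHw] x /=; first by move->; rewrite walk_gain_nil act1.
case=> /satA satd <- /IHw ->.
by rewrite walk_gain_cons actM; move: satd; rewrite /satisfied => ->.
Qed.

(** These are the spins that a state satisfying [A] can take at [r]: transport around a closed walk
    must return to the same spin. *)
Definition fixed_spins A r : {set Q} :=
  [set q | `[< forall w, walk A r w r -> act q (walk_gain w) = q >]]%SET.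

(** Transport along walks determines a satisfying state from its spins at the roots, and any choice
    of a fixed spin at each root extends to such a state. *)
Lemma card_satisfied_states A :
  #|satisfied_states A| = \prod_(r | roots (adjacent A) r) #|fixed_spins A r|.
Proof.
have csym := connect_adjacent_sym A; set e := adjacent A in csym *.
(* Restriction to the roots, with [None] elsewhere: this gives a value off the roots even when [Q]
   is empty. *)
pose t s := [ffun v => if roots e v then Some (s v) else None].
have root_walk v : exists w, walk A (root e v) w v.
  by apply/connectP_walk; rewrite csym connect_root.
rewrite -(card_in_imset (f := t)) => [|s1 s2 sat1 sat2 eqt]; last first.
  apply/ffunP => v; have [w wv] := root_walk v.
  rewrite (satisfied_walk sat1 wv) (satisfied_walk sat2 wv).
  by move/ffunP/(_ (root e v)): eqt; rewrite !ffunE roots_root // => -[->].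
pose F r := mem (Some @: fixed_spins A r)%SET.
transitivity #|pfamily None (roots e) F|; last first.
  rewrite card_pfamily foldrE big_image /=; apply: eq_bigr => r _.
  by rewrite card_imset //; apply: Some_inj.
apply: eq_card => u; apply/imsetP/pfamilyP => [[s satA ->]|[/fintype.subsetP suppu uF]].
  split=> [|r]; first by apply/fintype.subsetP => v; rewrite inE ffunE; case: ifP.
  rewrite -topredE /= => er; rewrite ffunE er; apply/imsetP; exists (s r) => //.
  by rewrite inE; apply/asboolP => w /(satisfied_walk satA).
have /choice[q Dq] : forall v, exists q, u (root e v) = Some q /\
    q \in fixed_spins A (root e v).
  move=> v; have /imsetP[q qf ->] : u (root e v) \in F (root e v).
    by apply: uF; rewrite -topredE /= roots_root.
  by exists q.
have [p Dp] := choice root_walk.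
pose s := [ffun v => act (q v) (walk_gain (p v))].
have sroot v : roots e v -> s v = q v.
  move=> /eqP ev; rewrite ffunE; have [_] := Dq v; rewrite ev inE => /asboolP.
  by apply; rewrite -{1}ev.
exists s; last first.
  apply/ffunP => v; rewrite ffunE; case: ifP => ev.
    by rewrite sroot //; case: (Dq v) => <- _; rewrite (eqP ev).
  by apply/eqP; apply: contraFT ev => uv; apply: suppu; rewrite inE.
apply/satisfied_statesP => d Ad; rewrite /satisfied !ffunE -actM.
have eqr : root e (target d) = root e (source d).
  apply/esym/rootP => //; apply: connect1; apply/asboolP; by exists d.
have eqq : q (target d) = q (source d).
  by have [+ _] := Dq (target d); rewrite eqr; case: (Dq (source d)) => -> _ [].
have /asboolP fixq : `[< forall w, walk A (root e (source d)) w
    (root e (source d)) -> act (q (source d)) (walk_gain w) = q (source d) >].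
  by have [_] := Dq (source d); rewrite inE.
(* From the root to the source of [d], across [d], and back from its target: that the gain of this
   closed walk fixes the root spin is exactly satisfaction of [d]. *)
have := fixq (p (source d) ++ d :: rev_walk (p (target d))).
rewrite walk_gain_cat walk_gain_cons walk_gain_rev mulgA => {}fixq.
rewrite eqq -{1}fixq; first by rewrite -actM mulgVK.
apply/walk_cat; exists (source d) => //=; split=> //.
by rewrite -eqr; apply: walk_rev.
Qed.

End Action.
End CountingStates.

(** * Inclusion-exclusion over finite lists of edges *)

Section InclusionExclusion.
Variables (G : groupType) (Q : finType) (act : Q -> G -> Q).
Hypothesis act_right : is_right_action act.

Definition seq_edges (Phi : gain_graph G) (A : seq (edge Phi)) :
  set (edge Phi) := fun e => e \in A.

(** These sets interpolate between the satisfying states of [A] (empty [B]) and the totally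
    frustrated states (empty [A], large enough [B]). Lists keep both edge sets finite. *)
Definition partly_frustrated_states (Phi : gain_graph G) (A B : seq (edge Phi)) :
  {set {ffun vertex Phi -> Q}} :=
  [set s in satisfied_states act (seq_edges A)
     | all (fun e => ~~ `[< satisfied act s (e, false) >]) B]%SET.

Lemma in_partly_frustrated (Phi : gain_graph G) (A B : seq (edge Phi)) s :
  (s \in partly_frustrated_states A B) =
  (s \in satisfied_states act (seq_edges A)) &&
    all (fun e => ~~ `[< satisfied act s (e, false) >]) B.
Proof. by rewrite inE. Qed.

Lemma card_partly_frustrated_cons (Phi : gain_graph G) A e B :
  #|partly_frustrated_states (Phi := Phi) (e :: A) B| +
    #|partly_frustrated_states A (e :: B)| = #|partly_frustrated_states A B|.
Proof.
rewrite -(cardsID [set s : {ffun vertex Phi -> Q} |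
                    `[< satisfied act s (e, false) >]]%SET
                  (partly_frustrated_states A B)).
congr (_ + _); apply: eq_card => s.
  rewrite finset.in_setI !in_partly_frustrated !inE andbAC; congr (_ && _).
  rewrite -asbool_and; apply: asbool_equiv_eq; split=> [sat|[sat sate] e'].
    split=> [e' e'A|]; apply: sat; last exact: mem_head.
    by rewrite /seq_edges inE; apply/orP; right.
  by rewrite /seq_edges inE => /orP[/eqP->|/sat].
rewrite finset.in_setD !in_partly_frustrated andbCA; congr (_ && _).
by rewrite /= finset.in_set.
Qed.

(** There are finitely many states, and one satisfied edge excludes each state that is not totally
    frustrated. Allowing every larger list lets the lists of two graphs be merged. *)
Lemma chromatic_finite_edges (Phi : gain_graph G) :
  exists B : seq (edge Phi), forall B', {subset B <= B'} ->
    chromatic Phi act = #|partly_frustrated_states [::] B'|.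
Proof.
have /choice[b Db] : forall s : {ffun vertex Phi -> Q}, exists b : seq (edge Phi),
    ~ totally_frustrated act s ->
    exists2 e, e \in b & satisfied act s (e, false).
  move=> s; have [fs|nfs] := EM (totally_frustrated act s); first by exists [::].
  have [[e sat]|nsat] := EM (exists e, satisfied act s (e, false)).
    by exists [:: e] => _; exists e; rewrite ?mem_head.
  exists [::] => _; case: nfs => -[e b] sat; apply: nsat; exists e.
  by case: b sat => // sat; apply: satisfied_rev.
exists (flatten (map b (enum {ffun vertex Phi -> Q}))) => B' bB'.
apply: eq_card => s; rewrite !inE.
rewrite [X in X && _](_ : _ = true); last by apply/asboolP.
apply/asboolP/allP => [fs e _|fB]; first by apply/asboolP; apply: fs.
apply: contrapT => /(Db s)[e es sat].
have /fB/asboolP // : e \in B'.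
by apply: bB'; apply/flatten_mapP; exists s; rewrite ?mem_enum.
Qed.

Lemma eq_chromatic (Phi Psi : gain_graph G) (f : edge Phi -> edge Psi) :
  bijective f ->
  (forall A, #|satisfied_states act (f @` A)%classic| =
             #|satisfied_states act A|) ->
  chromatic Phi act = chromatic Psi act.
Proof.
move=> [f' fK f'K] eqf.
(* Induction on [B]: splitting by whether [e] is satisfied moves [e] from the frustrated list to the
   satisfied one, until only satisfying states are counted. *)
have eqN B A : #|partly_frustrated_states (map f A) (map f B)| =
    #|partly_frustrated_states A B|.
  elim: B A => [|e B IHB] A; last first.
    by apply: (@addnI #|partly_frustrated_states (e :: A) B|);
       rewrite card_partly_frustrated_cons -!IHB /= card_partly_frustrated_cons.
  have noB Phi' (A' : seq (edge Phi')) :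
      partly_frustrated_states A' [::] = satisfied_states act (seq_edges A').
    by apply/setP => s; rewrite in_partly_frustrated andbT.
  rewrite !noB -eqf; congr #|pred_of_set (satisfied_states act _)|.
  apply/predeqP => e; split=> [/mapP[e' e'A ->]|[e' e'A <-]]; first by exists e'.
  exact: map_f.
have [B DB] := chromatic_finite_edges Phi.
have [C DC] := chromatic_finite_edges Psi.
(* [B] together with the preimage of [C] is large enough for [Phi], and its image is large enough
   for [Psi]. *)
rewrite (DB (B ++ map f' C)) => [|e eB]; last by rewrite mem_cat eB.
rewrite (DC (map f (B ++ map f' C))) => [|e eC]; last first.
  by rewrite map_cat mem_cat -map_comp (eq_map f'K) map_id eC orbT.
by rewrite -eqN.
Qed.

End InclusionExclusion.

(** * Balanced subsets with the same connectivity *)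

Section SpanningForest.
Variables (G : groupType) (Phi : gain_graph G).
Implicit Types A F : set (edge Phi).

(** Sending each root for [A] to its root for [F] is injective, since vertices joined by [F] are
    joined by [A]. *)
Lemma num_components_connect_sub A F :
  (forall x y, connect (adjacent F) x y -> connect (adjacent A) x y) ->
  num_components A <= num_components F.
Proof.
move=> FA; rewrite !num_componentsE.
have symF := connect_adjacent_sym F; have symA := connect_adjacent_sym A.
rewrite -(card_in_imset (f := root (adjacent F)) (D := mem (roots (adjacent A)))).
  apply/subset_leq_card/fintype.subsetP => _ /imsetP[x _ ->].
  exact: roots_root.
move=> x y /eqP xA /eqP yA /(rootP symF)/FA/(rootP symA).
by rewrite xA yA.
Qed.

(** A simple closed walk through [e], rotated to start there, does not use [e] again, so its
    remainder would join the ends of [e] within [F]. *)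
Lemma balanced_bridge F e :
  balanced F -> ~ connect (adjacent F) (tail0 Phi e) (head0 Phi e) ->
  balanced (F `|` [set e])%classic.
Proof.
move=> balF bridge w sw wFe.
have [/mapP[d dw De]|ew] := boolP (e \in map fst w); last first.
  apply: balF => // d dw; have [//|/= De] := wFe d dw.
  by rewrite -De map_f in ew.
case/and4P: sw => _ cw _; case/rot_to: dw cw wFe => i p rotw cw wFe.
rewrite -(rot_uniq i) -map_rot rotw /= => /andP[dp _].
have wp : walk (F `|` [set e])%classic (source d) (d :: p) (source d).
  apply/cycle_walk; split=> [|d']; first by rewrite -rotw rot_cycle.
  by rewrite -rotw mem_rot => /wFe.
have {wp} [_ _ wp] := wp; case: bridge.
suff : connect (adjacent F) (target d) (source d).
  by rewrite De; case: (d) => e' [] //=; rewrite connect_adjacent_sym.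
apply/connectP_walk; exists p; apply: walk_sub wp => d' d'p [//|/= De'].
by rewrite -De -De' map_f in dp.
Qed.

(** Choose a balanced subset of [A] that connects the most pairs of vertices. An edge of [A] between
    unconnected vertices could be added by [balanced_bridge] and would connect more. Pairs are
    counted rather than edges, which may be infinite in number. *)
Lemma spanning_balanced A :
  exists F, [/\ (F `<=` A)%classic, balanced F &
    connect (adjacent F) =2 connect (adjacent A)].
Proof.
pose pairs F := #|[set p | connect (adjacent F) p.1 p.2]%SET|.
pose good n := `[< exists F, [/\ (F `<=` A)%classic, balanced F & pairs F = n] >].
have [|n|n /asboolP[F [FA balF <-]] maxF] := @ex_maxnP good #|{: vertex Phi * vertex Phi}|.
- exists (pairs (fun _ => False)); apply/asboolP; exists (fun _ => False).
  split=> // -[|d w] // _ Aw; have := Aw d; rewrite mem_head; by move/(_ isT).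
- by move=> /asboolP[F [_ _ <-]]; apply: max_card.
exists F; split=> // x y; apply/idP/idP; first exact: sub_connect_adjacent.
apply: connect_sub => {}x {}y /asboolP[d [Ad dx dy]].
apply: contrapT => /negP nxy.
pose F' := (F `|` [set d.1])%classic.
have nd : ~ connect (adjacent F) (tail0 Phi d.1) (head0 Phi d.1).
  apply/negP; move: nxy; rewrite -dx -dy.
  by case: (d) => e [] //=; rewrite connect_adjacent_sym.
have FF' : (F `<=` F')%classic by move=> e; left.
have /maxF : good (pairs F').
  apply/asboolP; exists F'; split=> //; last exact: balanced_bridge.
  by move=> e [/FA|->].
apply/negP; rewrite -ltnNge; apply/proper_card/properP; split.
  by apply/fintype.subsetP => p; rewrite !inE; apply: sub_connect_adjacent.
exists (x, y); rewrite inE //=; apply: connect1; apply/asboolP.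
by exists d; split=> //; right.
Qed.

End SpanningForest.

(** * Sufficiency of the conditions on the action *)

Section SufficientConditions.
Variables (G : groupType) (Q : finType) (act : Q -> G -> Q).
Hypothesis act_right : is_right_action act.

Lemma closed_walks_trivial_fixed_spins (Phi : gain_graph G)
    (A : set (edge Phi)) r :
  closed_walks_trivial A r -> fixed_spins act A r = [set: Q]%SET.
Proof.
move=> triv; apply/setP => q; rewrite !inE; apply/asboolP => w /triv ->.
exact: act1.
Qed.

(** A root of a balanced component contributes the factor [#|Q|]. At any other root some closed walk
    has nonidentity gain, which leaves only [q0], a spin fixed by every gain. *)
Lemma card_satisfied_states_common_fixed q0 (Phi : gain_graph G)
    (A : set (edge Phi)) :
  (forall g, g <> 1%g -> fixed_set act g = [set q0]%SET) ->
  #|satisfied_states act A| = #|Q| ^ num_balanced_components A.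
Proof.
move=> fixq0; rewrite (card_satisfied_states act_right).
rewrite num_balanced_componentsE -prod_nat_const.
rewrite [RHS](eq_bigl (fun r => roots (adjacent A) r &&
  `[< closed_walks_trivial A r >])) => [|r]; last by rewrite inE.
rewrite [RHS]big_mkcondr; apply: eq_bigr => r _.
case: (asboolP (closed_walks_trivial A r)) => [triv|ntriv].
  by rewrite closed_walks_trivial_fixed_spins // cardsT.
rewrite -(cards1 q0); congr #|pred_of_set _|; apply/setP => q.
have [w [wr /fixq0 gq0]] : exists w, walk A r w r /\ walk_gain w <> 1%g.
  apply: contrapT => nw; apply: ntriv => w wr; apply: contrapT => w1.
  by apply: nw; exists w.
rewrite !inE; apply/asboolP/eqP => [/(_ w wr) qw|-> w' _].
  by apply/eqP; rewrite -finset.in_set1 -gq0 inE qw.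
have [->|/eqP /fixq0 /setP/(_ q0)] := eqVneq (walk_gain w') 1%g.
  exact: act1.
by rewrite !inE eqxx => /eqP.
Qed.

Lemma card_satisfied_states_trivial (Phi : gain_graph G) (A : set (edge Phi)) :
  trivial_action act -> #|satisfied_states act A| = #|Q| ^ num_components A.
Proof.
move=> triv; rewrite (card_satisfied_states act_right) num_componentsE.
rewrite -prod_nat_const; apply: eq_bigr => r _.
rewrite -cardsT; congr #|pred_of_set _|; apply/setP => q.
rewrite !inE; apply/asboolP => w _; apply/eqP.
by have := triv (walk_gain w) q; rewrite inE.
Qed.

Lemma card_satisfied_states_balanced (Phi : gain_graph G) (A : set (edge Phi)) :
  balanced A -> #|satisfied_states act A| = #|Q| ^ num_components A.
Proof.
move=> /balancedP balA; rewrite (card_satisfied_states act_right).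
rewrite num_componentsE -prod_nat_const; apply: eq_bigr => r _.
by rewrite closed_walks_trivial_fixed_spins ?cardsT //; apply: balA.
Qed.

(** In a satisfying state the gain of every closed walk fixes a spin, so by regularity it is 1 and
    [A] is balanced. *)
Lemma card_satisfied_states_regular (Phi : gain_graph G) (A : set (edge Phi)) :
  regular_action act -> ~ balanced A -> #|satisfied_states act A| = 0.
Proof.
move=> reg nbal; apply/eqP; rewrite cards_eq0; apply/eqP/setP => s.
rewrite !inE; apply/negP => sat; apply: nbal; apply/balancedP => x w wx.
apply: (reg _ (s x)); rewrite inE; apply/eqP/esym.
by apply: (satisfied_walk act_right _ wx); rewrite inE.
Qed.

Lemma frame_matroid_determines q0 :
  (forall g, g <> 1%g -> fixed_set act g = [set q0]%SET) ->
  chromatic_determined_by act (@frame_matroid_iso G).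
Proof.
move=> fixq0 Phi Psi [f bijf rankf] _ eqb.
have fT : (f @` [set: edge Phi])%classic = [set: edge Psi]%classic.
  apply/predeqP => e; split=> // _; have [f' _ f'K] := bijf.
  by exists (f' e).
(* This bound makes the truncated subtraction in [frame_rank] exact, so ranks determine numbers of
   balanced components once the vertex numbers agree. *)
have le_b (Phi' : gain_graph G) (A : set (edge Phi')) :=
  leq_trans (num_balanced_components_le A) (num_components_le A).
have eqn : #|vertex Phi| = #|vertex Psi|.
  have := rankf [set: edge Phi]%classic; rewrite fT /frame_rank eqb.
  have := le_b _ [set: edge Psi]%classic; have := le_b _ [set: edge Phi]%classic.
  by rewrite eqb; lia.
apply: (eq_chromatic act_right bijf) => A.
rewrite !(card_satisfied_states_common_fixed _ fixq0); congr (_ ^ _).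
have := rankf A; rewrite /frame_rank eqn.
by have := le_b _ A; have := le_b _ (f @` A)%classic; rewrite eqn; lia.
Qed.

(** A balanced [F] spanning the components of [A] has rank [#|vertex Phi|] minus the number of
    components of [A], and its image has the same rank. The image of [A] may still connect more than
    that of [F], hence only an inequality; the inverse of [f] yields the other one. *)
Lemma semimatroid_num_components (Phi Psi : gain_graph G)
    (f : edge Phi -> edge Psi) :
  (forall A, (balanced (f @` A)%classic <-> balanced A) /\
     (balanced A -> frame_rank (f @` A)%classic = frame_rank A)) ->
  forall A, num_components (f @` A)%classic + #|vertex Phi| <=
            num_components A + #|vertex Psi|.
Proof.
move=> isof A; have [F [FA balF FAc]] := spanning_balanced A.
have [balfF rankF] := isof F; have {}rankF := rankF balF.
have {}balfF := balfF.2 balF.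
have cFA : num_components F <= num_components A.
  by apply: num_components_connect_sub => x y; rewrite FAc.
have cfFA : num_components (f @` A)%classic <= num_components (f @` F)%classic.
  apply: num_components_connect_sub => x y; apply: sub_connect_adjacent.
  by apply: image_subset.
have := num_components_le F; have := num_components_le (f @` F)%classic.
move: rankF; rewrite /frame_rank !balanced_num_components //; lia.
Qed.

Lemma semimatroid_iso_num_components (Phi Psi : gain_graph G)
    (f : edge Phi -> edge Psi) :
  bijective f ->
  (forall A, (balanced (f @` A)%classic <-> balanced A) /\
     (balanced A -> frame_rank (f @` A)%classic = frame_rank A)) ->
  num_components [set: edge Phi]%classic =
    num_components [set: edge Psi]%classic ->
  forall A, num_components (f @` A)%classic = num_components A.
Proof.
move=> [f' fK f'K] isof eqc.
have f'fA A : (f' @` (f @` A))%classic = A.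
  by rewrite image_comp (_ : f' \o f = id) ?image_id //; apply/funext.
have ff'B B : (f @` (f' @` B))%classic = B.
  by rewrite image_comp (_ : f \o f' = id) ?image_id //; apply/funext.
have isof' B : (balanced (f' @` B)%classic <-> balanced B) /\
    (balanced B -> frame_rank (f' @` B)%classic = frame_rank B).
  have [bal rank] := isof (f' @` B)%classic; rewrite ff'B in bal rank.
  by split=> [|/bal/rank/esym]; first exact: iff_sym.
have eqcn A : num_components (f @` A)%classic + #|vertex Phi| =
    num_components A + #|vertex Psi|.
  apply/eqP; rewrite eqn_leq (semimatroid_num_components isof) /=.
  by have := semimatroid_num_components isof' (f @` A)%classic; rewrite f'fA.
have fT : (f @` [set: edge Phi])%classic = [set: edge Psi]%classic.
  by apply/predeqP => e; split=> // _; exists (f' e).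
(* On the full edge set the component numbers agree, so the vertex numbers agree too. *)
by have := eqcn [set: edge Phi]%classic; rewrite fT eqc => eqn A;
   have := eqcn A; lia.
Qed.

Lemma balanced_semimatroid_determines :
  regular_action act \/ trivial_action act ->
  chromatic_determined_by act (@balanced_semimatroid_iso G).
Proof.
move=> reg_triv Phi Psi [f bijf isof] eqc _.
have eqcA := semimatroid_iso_num_components bijf isof eqc.
apply: (eq_chromatic act_right bijf) => A; case: reg_triv => [reg|triv].
  have [balA|nbalA] := EM (balanced A).
    by rewrite !card_satisfied_states_balanced ?eqcA //; apply/(isof A).1.
  by rewrite !card_satisfied_states_regular // => /(isof A).1.
by rewrite !card_satisfied_states_trivial ?eqcA.
Qed.

End SufficientConditions.

(** * Tools for computing with small gain graphs *)

Section SmallGraphs.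
Variables (G : groupType) (Phi : gain_graph G).
Implicit Types A : set (edge Phi).

Lemma unbalanced_loop A e :
  A e -> tail0 Phi e = head0 Phi e -> gain Phi (e, false) <> 1%g -> ~ balanced A.
Proof.
move=> Ae loop g1 /balancedP/(_ (tail0 Phi e) [:: (e, false)]).
by rewrite walk_gain_cons walk_gain_nil mulg1 => bal; apply: g1; apply: bal.
Qed.

Lemma balanced_empty A : (forall e, ~ A e) -> balanced A.
Proof. by move=> A0 [|d w] // _ /(_ d); rewrite mem_head => /(_ isT)/A0. Qed.

Lemma connect_loops A x y :
  (forall e, A e -> tail0 Phi e = head0 Phi e) ->
  connect (adjacent A) x y -> x = y.
Proof.
move=> loops /connectP_walk[w]; elim: w x => //= d w IHw x [Ad <- /IHw <-].
by case: d Ad => e []; rewrite /source /target /= => /loops.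
Qed.

Lemma roots_loops A x :
  (forall e, A e -> tail0 Phi e = head0 Phi e) -> roots (adjacent A) x.
Proof.
by move=> loops; apply/eqP/esym/(connect_loops loops); apply: connect_root.
Qed.

Lemma num_components_loops A :
  (forall e, A e -> tail0 Phi e = head0 Phi e) ->
  num_components A = #|vertex Phi|.
Proof.
move=> loops; rewrite num_componentsE; apply: eq_card => x.
by rewrite -topredE /= roots_loops.
Qed.

Lemma components_connected A x :
  (forall y, connect (adjacent A) x y) ->
  components A = [set [set: vertex Phi]%SET]%SET.
Proof.
move=> conn; apply/setP => X; rewrite finset.in_set1.
have all_conn y z : connect (adjacent A) y z.
  by apply: connect_trans (conn z); rewrite connect_adjacent_sym.
apply/imsetP/eqP => [[y _ ->]|->].
  by apply/setP => z; rewrite !inE all_conn.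
by exists x => //; apply/setP => z; rewrite !inE all_conn.
Qed.

Lemma num_components_connected A x :
  (forall y, connect (adjacent A) x y) -> num_components A = 1.
Proof. by move=> conn; rewrite /num_components (components_connected conn) cards1. Qed.

Lemma num_balanced_components_connected A x :
  (forall y, connect (adjacent A) x y) ->
  num_balanced_components A = `[< balanced A >].
Proof.
move=> conn; case: asboolP => [balA|nbalA].
  by rewrite balanced_num_components // (num_components_connected conn).
apply/eqP; rewrite cards_eq0; apply/eqP/setP => X.
rewrite !inE (components_connected conn) !inE; apply/negP => /andP[/eqP-> /asboolP].
by move=> bal; apply: nbalA; apply: sub_balanced bal => e Ae; split; rewrite ?inE.
Qed.

Lemma totally_frustrated_edges (Q : finType) (act : Q -> G -> Q)
    (s : {ffun vertex Phi -> Q}) :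
  is_right_action act ->
  totally_frustrated act s <-> forall e, ~ satisfied act s (e, false).
Proof.
move=> act_right; split=> [fs e|fs [e []]]; [exact: fs| |exact: fs].
by move=> /(@satisfied_rev _ _ _ _ act_right s (e, false)); apply: fs.
Qed.

End SmallGraphs.

(** * Necessity of the conditions, by explicit small graphs *)

Section NecessaryConditions.
Variable G : groupType.

Section OrientedGains.
Variables (V : finType) (E : choiceType) (t h : E -> V) (phi : E -> G).

Definition oriented_gain (d : E * bool) : G :=
  if d.2 then (phi d.1)^-1%g else phi d.1.

Lemma oriented_gainV e b :
  oriented_gain (e, ~~ b) = (oriented_gain (e, b))^-1%g.
Proof. by case: b; rewrite /oriented_gain //= invgK. Qed.

Definition oriented_gain_graph : gain_graph G := GainGraph t h oriented_gainV.

End OrientedGains.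

Lemma connect_edge (Phi : gain_graph G) (A : set (edge Phi)) e :
  A e -> connect (adjacent A) (tail0 Phi e) (head0 Phi e).
Proof. by move=> Ae; apply: connect1; apply/asboolP; exists (e, false). Qed.

Definition bouquet (g h : G) : gain_graph G :=
  @oriented_gain_graph unit bool (fun=> tt) (fun=> tt) (fun e => if e then h else g).

Lemma bouquet_balanced g h (A : set (edge (bouquet g h))) :
  g <> 1%g -> h <> 1%g -> balanced A <-> forall e : bool, ~ A e.
Proof.
move=> g1 h1; split=> [balA e Ae|A0]; last exact: balanced_empty.
by apply: (unbalanced_loop Ae) balA; case: (e).
Qed.

(** For [u = true] this is a link with a loop of gain [g] at its head; for [u = false] it is a digon
    of gains 1 and [g]. *)
Definition two_edges (u : bool) (g : G) : gain_graph G :=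
  @oriented_gain_graph bool bool (fun e => if e then u else false) (fun=> true)
    (fun e => if e then g else 1%g).

(** Either edge removes one balanced component, by merging two of them or by unbalancing one,
    whatever [u] is. *)
Lemma two_edges_num_balanced u g (A : set bool) :
  g <> 1%g ->
  @num_balanced_components G (two_edges u g) A =
    ~~ `[< A false >] + ~~ `[< A true >].
Proof.
move=> g1.
have conn (A' : set (edge (two_edges u g))) :
    A' false \/ A' true /\ u = false -> forall y, connect (adjacent A') false y.
  move=> link; suff ft: connect (adjacent A') false true.
    by case; rewrite ?connect0.
  case: link => [|[A1 Du]]; first exact: (@connect_edge _ A' false).
  by have := @connect_edge _ A' true A1; rewrite /= Du.
(* The condition [e -> u = false] says that [e] is a link; a single link is a bridge. *)
have single (e : bool) : (e -> u = false) -> @balanced _ (two_edges u g) [set e]%classic.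
  move=> link.
  rewrite -[X in balanced X]set0U; apply: balanced_bridge.
    by apply: balanced_empty => ? [].
  move/connect_loops => /= ft; have {ft} : (if e then if e then u else false else false) = true.
    by case: (e) ft => // ft; apply: ft => ? [].
  by case: (e) link => // ->.
have [A0|nA0] := asboolP (A false); have [A1|nA1] := asboolP (A true).
- rewrite (num_balanced_components_connected (conn A (or_introl A0))).
  case: asboolP => // balA; exfalso; have [Du|/negbTE Du] := boolP u.
    by apply: (@unbalanced_loop G (two_edges u g) A true A1 _ g1 balA); rewrite /= Du.
  (* Around the digon: out along the edge of gain [g], back along the edge of gain 1. *)
  move/balancedP/(_ false [:: (true, false); (false, true)]): balA.
  rewrite !walk_gain_cons walk_gain_nil mulg1 /= /oriented_gain /= invg1 mulg1.
  by move=> bal; apply: g1; apply: bal; rewrite /source /= Du.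
- rewrite (num_balanced_components_connected (conn A (or_introl A0))).
  rewrite asboolT //; apply: sub_balanced (single false _) => //.
  by case=> // /nA1.
- case/orP: (orbN u) => Du.
    have loops e : A e -> tail0 (two_edges u g) e = head0 (two_edges u g) e.
      by case: e => [_|/nA0 //]; rewrite /= Du.
    have root_all r : roots (adjacent (Phi := two_edges u g) A) r.
      exact: (@roots_loops _ (two_edges u g)).
    rewrite num_balanced_componentsE -[RHS]/1%N -(cards1 false).
    apply: eq_card => r; rewrite !inE root_all /=.
    apply/asboolP/eqP => [triv|->].
      case: r triv => // /(_ [:: (true, false)]).
      rewrite walk_gain_cons walk_gain_nil mulg1 => triv.
      by exfalso; apply: g1; apply: triv; rewrite /source /= Du.
    case=> [|[[] b] w] /=; [by rewrite walk_gain_nil| |by case=> /nA0].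
    by case=> _; rewrite /source; case: b; rewrite /= ?Du.
  rewrite (num_balanced_components_connected (conn A (or_intror (conj A1 (negbTE Du))))).
  rewrite asboolT //; apply: sub_balanced (single true _) => //; last by move=> _; apply/negbTE.
  by case=> // /nA0.
- have A_ e : ~ A e by case: e.
  rewrite balanced_num_components; last exact: balanced_empty.
  by rewrite num_components_loops ?card_bool // => e /A_.
Qed.

Lemma two_edges_num_components u g :
  @num_components G (two_edges u g) [set: edge (two_edges u g)]%classic = 1.
Proof.
apply: (@num_components_connected G (two_edges u g) _ false); case; rewrite ?connect0 //.
exact: (@connect_edge (two_edges u g) _ false).
Qed.

(** A link [None] of gain 1 with a loop of gain [g] at [false] and a loop of gain [h] at [u], so [u]
    chooses the end carrying the second loop. *)
Definition theta (u : bool) (g h : G) : gain_graph G :=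
  @oriented_gain_graph bool (option bool)
    (fun e => if e is Some true then u else false)
    (fun e => if e is Some b then b && u else true)
    (fun e => if e is Some b then if b then h else g else 1%g).

Lemma theta_balanced u g h (A : set (option bool)) :
  g <> 1%g -> h <> 1%g ->
  @balanced G (theta u g h) A <-> forall b, ~ A (Some b).
Proof.
move=> g1 h1; split=> [balA b Ab|A0].
  by apply: (@unbalanced_loop G (theta u g h) A (Some b) Ab) balA; case: (b).
apply: (@sub_balanced G (theta u g h) A (set0 `|` [set None])%classic).
  by case=> [b /A0|_] //; right.
apply: balanced_bridge; first by apply: balanced_empty => ? [].
by move/connect_loops => /= ft; have // : false = true by apply: ft => ? [].
Qed.

Lemma theta_num_components u g h (A : set (option bool)) :
  @num_components G (theta u g h) A = if `[< A None >] then 1 else 2.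
Proof.
case: asboolP => [AN|nAN].
  apply: (@num_components_connected G (theta u g h) _ false); case; rewrite ?connect0 //.
  exact: (@connect_edge (theta u g h) A None AN).
rewrite (@num_components_loops G (theta u g h)) ?card_bool // => -[[]|] //=.
Qed.

(** With nonidentity loop gains the balanced sets are those without loops, and their ranks depend
    only on whether the link is present. *)
Lemma theta_balanced_semimatroid u v g h g' h' :
  g <> 1%g -> h <> 1%g -> g' <> 1%g -> h' <> 1%g ->
  balanced_semimatroid_iso (theta u g h) (theta v g' h').
Proof.
move=> g1 h1 g1' h1'; exists id; first by exists id.
move=> A; rewrite image_id; split.
  by rewrite !theta_balanced.
move=> balA; have balA' : @balanced _ (theta v g' h') A.
  by apply/theta_balanced => //; apply: (@theta_balanced u g h A g1 h1).1.
by rewrite /frame_rank !balanced_num_components // !theta_num_components.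
Qed.

Lemma theta_components_full u g h :
  @num_components G (theta u g h) [set: edge (theta u g h)]%classic = 1.
Proof. by rewrite theta_num_components asboolT. Qed.

Lemma theta_balanced_components_full u g h :
  g <> 1%g -> h <> 1%g ->
  @num_balanced_components G (theta u g h) [set: edge (theta u g h)]%classic = 0.
Proof.
move=> g1 h1; rewrite (@num_balanced_components_connected G (theta u g h) _ false).
  by rewrite asboolF // => /theta_balanced => /(_ g1 h1 false); apply.
case; rewrite ?connect0 //.
exact: (@connect_edge (theta u g h) _ None).
Qed.

Variables (Q : finType) (act : Q -> G -> Q).
Hypothesis act_right : is_right_action act.

Lemma chromatic_bouquet g h :
  chromatic (bouquet g h) act =
  #|[set s : {ffun unit -> Q} | (act (s tt) g != s tt) && (act (s tt) h != s tt)]%SET|.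
Proof.
apply: eq_card => s; rewrite !inE; apply/asboolP/andP.
  move=> fs; split; apply/eqP => sat.
    by apply: (fs (false, false)); apply: esym sat.
  by apply: (fs (true, false)); apply: esym sat.
case=> /eqP sg /eqP sh; apply/(totally_frustrated_edges _ act_right).
by case=> /esym; [apply: sh|apply: sg].
Qed.

Lemma chromatic_two_edges u g :
  chromatic (two_edges u g) act =
  #|[set s : {ffun bool -> Q} |
      (s true != s false) && (s true != act (s u) g)]%SET|.
Proof.
apply: eq_card => s; rewrite !inE; apply/asboolP/andP.
  move=> fs; split; apply/eqP => sat.
    by apply: (fs (false, false)); rewrite /satisfied /= act1.
  exact: (fs (true, false) sat).
case=> /eqP s1 /eqP sg; apply/(totally_frustrated_edges _ act_right).
case=> //; rewrite /satisfied /source /target /= /oriented_gain /= act1 //.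
Qed.

Lemma chromatic_theta u g h :
  chromatic (theta u g h) act =
  #|[set s : {ffun bool -> Q} | [&& s true != s false,
      act (s false) g != s false & act (s u) h != s u]]%SET|.
Proof.
apply: eq_card => s; rewrite !inE; apply/asboolP/and3P.
  move=> fs; split; apply/eqP => sat.
  - by apply: (fs (None, false)); rewrite /satisfied /= /oriented_gain /= act1.
  - by apply: (fs (Some false, false)); rewrite /satisfied /=; apply: esym sat.
  - by apply: (fs (Some true, false)); rewrite /satisfied /=; apply: esym sat.
case=> /eqP s1 /eqP sg /eqP sh; apply/(totally_frustrated_edges _ act_right).
case=> [[]|]; rewrite /satisfied /source /target /= /oriented_gain /= ?act1 //;
  by move/esym.
Qed.

Definition two_spins (x y : Q) : {ffun bool -> Q} :=
  [ffun b : bool => if b then y else x].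

Lemma semimatroid_necessary :
  chromatic_determined_by act (@balanced_semimatroid_iso G) ->
  regular_action act \/ trivial_action act.
Proof.
move=> det.
have eq_theta u v g h g' h' : g <> 1%g -> h <> 1%g -> g' <> 1%g -> h' <> 1%g ->
    chromatic (theta u g h) act = chromatic (theta v g' h') act.
  move=> *; apply: det; first exact: theta_balanced_semimatroid.
    by rewrite !theta_components_full.
  by rewrite !theta_balanced_components_full.
(* Moving the second loop to the other end shows that a nonidentity [g] with one fixed spin [q]
   fixes all: otherwise a moved spin [x] at [false] and [q] at [true] would be counted on one side
   only. *)
have fix_all g q x : g <> 1%g -> act q g = q -> act x g = x.
  move=> g1 qg; apply: contrapT => /eqP xg.
  have := eq_theta true false g g g g g1 g1 g1 g1; rewrite !chromatic_theta.
  apply/eqP; rewrite neq_ltn; apply/orP; left; apply/proper_card/properP; split.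
    by apply/fintype.subsetP => s; rewrite !inE => /and3P[-> -> _].
  have qx : q != x by apply/eqP => qx; rewrite -qx qg eqxx in xg.
  by exists (two_spins x q); rewrite !inE !ffunE ?qg ?eqxx ?andbF // qx xg.
have [reg|nreg] := EM (regular_action act); [by left|right => h q'].
rewrite inE; apply/eqP; apply: contrapT => q'h; apply: nreg => g q.
rewrite inE => /eqP qg; apply: contrapT => g1.
have h1 : h <> 1%g by move=> h1; apply: q'h; rewrite h1 act1.
(* Now [g] fixes every spin, so loops of gain [g] leave no frustrated state, while loops of gain [h]
   at [false] are frustrated by the spin [q']. *)
have := eq_theta false false g g h h g1 g1 h1 h1; rewrite !chromatic_theta.
apply/eqP; rewrite neq_ltn; apply/orP; left; apply/proper_card/properP; split.
  apply/fintype.subsetP => s; rewrite !inE => /and3P[_ /eqP sg _].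
  by case: sg; apply: fix_all qg.
exists (two_spins q' (act q' h)); rewrite !inE !ffunE.
  by move/eqP: q'h => ->.
by rewrite (fix_all g q q' g1 qg) eqxx andbF.
Qed.

Lemma frame_matroid_necessary :
  0 < #|Q| ->
  chromatic_determined_by act (@frame_matroid_iso G) ->
  exists q0 : Q, forall g : G, g <> 1%g -> fixed_set act g = [set q0]%SET.
Proof.
move=> Q_gt0 det.
have one_fixed g : g <> 1%g -> #|fixed_set act g| = 1.
  move=> g1.
  (* [E1] holds the states satisfying the link of gain 1, [E2 u] those satisfying the edge of gain
     [g]. On [E1] the two ends have equal spins, so [E2 true] and [E2 false] agree there; the
     chromatic functions compare them outside [E1]. *)
  pose E1 := [set s : {ffun bool -> Q} | s true == s false]%SET.
  pose E2 u := [set s : {ffun bool -> Q} | s true == act (s u) g]%SET.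
  have chi u : chromatic (two_edges u g) act = #|(~: E1 :\: E2 u)%SET|.
    rewrite chromatic_two_edges; apply: eq_card => s.
    by rewrite !inE andbC.
  have card_chi : #|(~: E1 :\: E2 true)%SET| = #|(~: E1 :\: E2 false)%SET|.
    rewrite -!chi; apply: det.
    - exists id; first by exists id.
      by move=> A; rewrite image_id /frame_rank !two_edges_num_balanced.
    - by rewrite !two_edges_num_components.
    - by rewrite !two_edges_num_balanced.
  have E12 : (E2 true :&: E1 = E2 false :&: E1)%SET.
    by apply/setP => s; rewrite !inE andbC [RHS]andbC; case: eqP => //= ->.
  have cardE2 : #|E2 true| = #|E2 false|.
    rewrite -(cardsID E1 (E2 true)) -(cardsID E1 (E2 false)) E12; congr (_ + _).
    have := cardsID (E2 true) (~: E1); rewrite card_chi.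
    rewrite -(cardsID (E2 false) (~: E1)) => /addIn.
    by rewrite !finset.setDE ![(~: E1 :&: _)%SET]finset.setIC.
  have card_false : #|E2 false| = #|Q|.
    rewrite -(card_in_imset (f := fun s : {ffun bool -> Q} => s false)).
      rewrite -cardsT; congr #|pred_of_set _|; apply/setP => q; rewrite inE.
      apply/imsetP; exists (two_spins q (act q g)); rewrite ?inE !ffunE //.
    move=> s1 s2; rewrite !inE => /eqP s1g /eqP s2g s12.
    by apply/ffunP; case; rewrite // s1g s2g s12.
  have card_true : #|E2 true| = #|Q| * #|fixed_set act g|.
    pose F (b : bool) := if b then mem (fixed_set act g) else mem [set: Q]%SET.
    transitivity #|family F|.
      apply: eq_card => s; rewrite inE; apply/eqP/familyP => [sg b|/(_ true)].
        by rewrite /F; case: b; rewrite inE // -sg.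
      by rewrite /F inE => /eqP.
    by rewrite card_family foldrE big_image big_bool /= mulnC cardsT.
  (* Cancelling the positive number [#|Q|] leaves exactly one fixed spin. *)
  by move: cardE2; rewrite card_true card_false; nia.
have [[g g1]|triv] := EM (exists g : G, g <> 1%g); last first.
  have /card_gt0P[q0 _] := Q_gt0; exists q0 => g g1.
  by case: triv; exists g.
have /eqP/cards1P[q0 gq0] := one_fixed g g1; exists q0 => h h1.
have /eqP/cards1P[q1 hq1] := one_fixed h h1; rewrite hq1.
apply: contrapT => ne_q.
have : chromatic (bouquet g h) act = chromatic (bouquet g g) act.
  have conn k l (A : set (edge (bouquet k l))) y : connect (adjacent A) tt y.
    by case: y; rewrite connect0.
  have bal : (forall A : set bool,
      @balanced G (bouquet g h) A <-> @balanced G (bouquet g g) A).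
    by move=> A; rewrite !bouquet_balanced.
  have eqb A : @num_balanced_components G (bouquet g h) A =
      @num_balanced_components G (bouquet g g) A.
    rewrite (num_balanced_components_connected (conn g h A)).
    rewrite (num_balanced_components_connected (conn g g A)).
    by rewrite (asbool_equiv_eq (bal A)).
  apply: det; last exact: eqb.
    exists id; first by exists id.
    by move=> A; rewrite image_id /frame_rank eqb.
  rewrite (num_components_connected (conn g h _)).
  by rewrite (num_components_connected (conn g g _)).
rewrite !chromatic_bouquet.
apply/eqP; rewrite neq_ltn; apply/orP; left; apply/proper_card/properP; split.
  by apply/fintype.subsetP => s; rewrite !inE => /andP[-> _].
have fixE k q : (act q k == q) = (q \in fixed_set act k) by rewrite inE.
(* The spin [q1] is moved by [g] but fixed by [h], so it frustrates two loops of gain [g] but not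
   loops of gains [g] and [h]. *)
exists [ffun _ => q1]; rewrite !inE !ffunE !fixE ?gq0 ?hq1 !inE ?eqxx ?andbF //.
by rewrite andbb; apply/eqP => q10; apply: ne_q; rewrite q10.
Qed.

End NecessaryConditions.

Theorem theorem3 (G : groupType) (Q : finType) (act : Q -> G -> Q)
  (act_right : is_right_action act) :
  (* (a) *)
  ((0 < #|Q|)%N ->
     (chromatic_determined_by act (@frame_matroid_iso G) <->
      exists q0 : Q, forall g : G, g <> 1%g -> fixed_set act g = [set q0]%SET))
  /\
  (* (b) *)
  (chromatic_determined_by act (@balanced_semimatroid_iso G) <->
   regular_action act \/ trivial_action act).
Proof.
split=> [Q_gt0|]; split.
- exact: frame_matroid_necessary.
- by case=> q0; apply: frame_matroid_determines.
- exact: semimatroid_necessary.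
- exact: balanced_semimatroid_determines.
Qed.
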